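(* For all integers $n\ge 1$ and $\delta\ge 0$, $F_1(n,\delta)=F_2(n,\delta)$; that is, the size of an optimal $(n,\delta)_2$-LP code is the same as the size of an optimal $(n,\delta)_1$-LP code.
   Context: $\{0,1\}^n$ is equipped with the Hamming distance $d_H$ (number of positions in which two vectors differ). A code of length $n$ is any subset of $\{0,1\}^n$. For an integer $s\ge 1$, an $(n,\delta)_s$-low power (LP) code is a family $(\mathcal{C}_i)_{i\in\mathbb{Z}_s}$ of codes of length $n$, indexed by $\mathbb{Z}_s=\mathbb{Z}/s\mathbb{Z}$, such that for every $i\in\mathbb{Z}_s$ one has $d_H(\mathsf{u},\mathsf{v})\le\delta$ for all $\mathsf{u}\in\mathcal{C}_i$ and $\mathsf{v}\in\mathcal{C}_{i+1}$. (So an $(n,\delta)_1$-LP code is a single code $\mathcal{C}$ in which any two codewords are at distance at most $\delta$.) $F_s(n,\delta)$ is the maximum of $\min_{i\in\mathbb{Z}_s}|\mathcal{C}_i|$ over all $(n,\delta)_s$-LP codes $(\mathcal{C}_i)_{i\in\mathbb{Z}_s}$; an $(n,\delta)_s$-LP code attaining this maximum is called optimal, and its size means $\min_{i\in\mathbb{Z}_s}|\mathcal{C}_i|$. *)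

(* Defs.v *)
From mathcomp Require Import all_boot.

Set Implicit Arguments.
Unset Strict Implicit.
Unset Printing Implicit Defensive.

Definition hamming (n : nat) (u v : n.-tuple bool) : nat :=
  #|[set i : 'I_n | tnth u i != tnth v i]|.

Definition code (n : nat) := {set n.-tuple bool}.

(* Families indexed by Z/sZ are functions on 'I_s; the successor i + 1
   modulo s is [ordS i]. In particular [ordS] is the identity on 'I_1. *)
Definition is_LP (s n delta : nat) (C : {ffun 'I_s -> code n}) : bool :=
  [forall i : 'I_s, [forall u in C i, [forall v in C (ordS i),
     hamming u v <= delta]]].

(* For s >= 1 this is the minimum of the #|C i|: the default value 2 ^ n is the
   cardinal of the whole space, hence never smaller than any #|C i|
   (see [LP_size_le] and [LP_size_attained]). *)
Definition LP_size (s n : nat) (C : {ffun 'I_s -> code n}) : nat :=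
  \big[minn/2 ^ n]_(i < s) #|C i|.

(* The family of empty codes is always admissible, so for s >= 1 this is a
   genuine maximum (see [F_attained]). *)
Definition F (s n delta : nat) : nat :=
  \max_(C : {ffun 'I_s -> code n} | is_LP delta C) LP_size C.

Definition optimal_LP (s n delta : nat) (C : {ffun 'I_s -> code n}) : Prop :=
  is_LP delta C /\ LP_size C = F s n delta.

Lemma LP_size_le (s n : nat) (C : {ffun 'I_s -> code n}) (i : 'I_s) :
  LP_size C <= #|C i|.
Proof.
rewrite /LP_size; have := mem_index_enum i.
elim: (index_enum _) => // j r IHr; rewrite inE big_cons geq_min.
by case/predU1P=> [<-|/IHr->]; rewrite ?leqnn ?orbT.
Qed.

Lemma LP_size_attained (s n : nat) (C : {ffun 'I_s -> code n}) :
  0 < s -> exists i : 'I_s, LP_size C = #|C i|.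
Proof.
case: s C => // s C _.
case: (@arg_minnP _ ord0 predT (fun i => #|C i|)) => // i _ min_i.
exists i; apply/eqP; rewrite eqn_leq LP_size_le /LP_size /=.
elim/big_ind: _ => [|x y ix iy|j _]; last exact: min_i.
  by rewrite (leq_trans (max_card _)) // card_tuple card_bool.
by rewrite leq_min ix.
Qed.

Lemma F_attained (s n delta : nat) :
  exists C : {ffun 'I_s -> code n}, optimal_LP delta C.
Proof.
have LP0 : is_LP delta [ffun i : 'I_s => set0 : code n].
  by apply/forallP=> i; apply/forall_inP=> u; rewrite ffunE inE.
rewrite /optimal_LP /F (bigmax_eq_arg _ LP0).
by case: arg_maxnP => // C LPC _; exists C.
Qed.

(* Main.v *)
(** The constant family gives F_1 <= F_2. Conversely, write
    K = 2 * vol n ((d + 1) / 2) in the cube of dimension n + 1, where vol n t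
    is the volume of a ball in the n-cube, interpolated linearly between
    consecutive integers. The key is a vertex-isoperimetric inequality: if a
    nonempty A satisfies |A| >= 2 vol n t, then its 1-neighbourhood has at
    least 2 vol n (t + 1) points. It is proved by induction on the dimension,
    splitting along the first coordinate: Pascal's rule
    vol (n+1) t = vol n t + vol n (t-1) holds for every real t, and
    log-concavity of the binomial coefficients makes vol n t |-> vol n (t+1)
    concave, so that the worst splitting is the one of a ball. If A and B are
    at cross-distance <= d and |A| >= K, then the (n-d)-neighbourhood of A
    misses the antipode of B, hence |B| <= 2^(n+1) - (2^(n+1) - K) = K.
    Finally K is the size of the diameter-d code
    { (b, u) | 2 * weight u + b <= d }. *)
Require Import Defs.
From mathcomp Require Import all_boot all_order all_algebra.
From mathcomp Require Import lra zify.

Set Implicit Arguments.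
Unset Strict Implicit.
Unset Printing Implicit Defensive.

Import Order.TTheory GRing.Theory Num.Theory.
Local Open Scope ring_scope.

(** * Interpolated ball volumes in the cube *)

(* For integer k, [vol n k] is the number of points at distance < k (not <= k)
   from a given point of the n-cube; [layer n k] is 'C(n, k), and 0 for k < 0. *)
Fixpoint vol (n : nat) (t : rat) : rat :=
  if n is m.+1 then vol m t + vol m (t - 1)
  else if t <= 0 then 0 else if t <= 1 then t else 1.

Fixpoint layer (n : nat) (k : int) : rat :=
  if n is m.+1 then layer m k + layer m (k - 1) else (k == 0)%:R.

(** Both arguments in Pascal's rule have the same fractional part, so linearity between consecutive
    integers survives the recursion. *)
Lemma vol_affine (n : nat) (k : int) (x : rat) :
  0 <= x <= 1 -> vol n (k%:~R + x) = vol n k%:~R + x * layer n k.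
Proof.
move=> x01; elim: n k => [|n IHn] k /=; last first.
  have := IHn (k - 1); rewrite rmorphB /= => IHn1.
  have -> : k%:~R + x - 1 = k%:~R - 1 + x by lra.
  by rewrite IHn IHn1; lra.
have [k0|k0|->] := ltgtP k 0.
- have k1 : k%:~R <= (-1 : rat) by rewrite -[-1]/((-1)%:~R) ler_int; lia.
  by rewrite mulr0; do ![case: ifPn]; lra.
- have k1 : (1 : rat) <= k%:~R by rewrite -[1]/(1%:~R) ler_int; lia.
  by rewrite mulr0; do ![case: ifPn]; lra.
- by rewrite mulr0z lexx mulr1; do ![case: ifPn]; lra.
Qed.

Lemma volS (n : nat) (k : int) :
  vol n (k%:~R + 1) = vol n k%:~R + layer n k.
Proof. by rewrite vol_affine ?mul1r // lexx ler01. Qed.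

Lemma vol_homo (n : nat) (s t : rat) : s <= t -> vol n s <= vol n t.
Proof.
elim: n s t => [|n IHn] s t le_st /=; first by do ![case: ifPn]; lra.
by rewrite lerD // IHn // lerB.
Qed.

Lemma vol_le0 (n : nat) (t : rat) : t <= 0 -> vol n t = 0.
Proof.
elim: n t => [|n IHn] t t0 /=; first by rewrite t0.
by rewrite !IHn ?addr0 //; lra.
Qed.

Lemma vol_ge0 (n : nat) (t : rat) : 0 <= vol n t.
Proof.
elim: n t => [|n IHn] t /=; first by do ![case: ifPn]; lra.
by rewrite addr_ge0.
Qed.

Lemma vol_full (n : nat) (t : rat) : n.+1%:R <= t -> vol n t = 2 ^+ n.
Proof.
elim: n t => [|n IHn] t; first by rewrite expr0 /=; do ![case: ifPn]; lra.
rewrite -natr1 => nt /=; have := ler0n rat n.+1 => n0.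
by rewrite !IHn ?exprS; lra.
Qed.

Lemma vol_le_full (n : nat) (t : rat) : vol n t <= 2 ^+ n.
Proof.
have [tn|/ltW nt] := leP t n.+1%:R; last by rewrite vol_full.
by rewrite -(@vol_full n n.+1%:R) // vol_homo.
Qed.

(** For integer [t], the complement of a ball is a ball around the antipode; strict radii make the
    parameters add up to [n + 1]. *)
Lemma vol_sym (n : nat) (t : rat) : vol n t + vol n (n.+1%:R - t) = 2 ^+ n.
Proof.
elim: n t => [|n IHn] t; first by rewrite expr0 /=; do ![case: ifPn]; lra.
rewrite [vol n.+1 t]/= [vol n.+1 (_ - _)]/= exprS.
have := IHn t; have := IHn (t - 1).
have -> : n.+1%:R - (t - 1) = n.+2%:R - t by rewrite -(natr1 n.+1); lra.
have -> : n.+2%:R - t - 1 = n.+1%:R - t by rewrite -(natr1 n.+1); lra.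
by lra.
Qed.

Lemma vol_strict (n : nat) (s t : rat) :
  0 <= s -> s < t -> s < n.+1%:R -> vol n s < vol n t.
Proof.
elim: n s t => [|n IHn] s t s0 st /=; first by do ![case: ifPn]; lra.
rewrite -natr1 => sn; have [s_n|n_s] := ltP s n.+1%:R.
  by rewrite ltr_leD ?IHn // vol_homo; lra.
have n1 : 1 <= n.+1%:R :> rat by rewrite ler1n.
by rewrite ler_ltD ?IHn ?vol_homo //; lra.
Qed.

(** [t] can exceed [s] only where [vol n] is already full; [0 <= s] excludes the flat part left of
    0, where the claim can fail. *)
Lemma vol_shift (n : nat) (s t : rat) :
  0 <= s -> vol n t <= vol n s -> vol n (t + 1) <= vol n (s + 1).
Proof.
move=> s0 ts; have [le_ts|lt_st] := leP t s; first by rewrite vol_homo // lerD2r.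
have [sn|ns] := ltP s n.+1%:R.
  by have := vol_strict s0 lt_st sn; lra.
rewrite [leRHS]vol_full ?vol_le_full //; lra.
Qed.

(** The induction locates the unit interval in which [x] is reached; the affine formula is then
    inverted there. *)
Lemma vol_inv (n : nat) (x : rat) :
  0 <= x <= 2 ^+ n -> exists2 s, 0 <= s & vol n s = x.
Proof.
case/andP=> x0; rewrite -(@vol_full n n.+1%:R) //.
elim: n.+1 => [|k IHk] xk.
  by exists 0 => //; move: xk; rewrite !vol_le0 //; lra.
have [/IHk//|kx] := leP x (vol n k%:R).
have := volS n k; rewrite -pmulrn natr1 => volk.
have c0 : 0 < layer n k by move: xk kx; rewrite volk; lra.
exists (k%:R + (x - vol n k%:R) / layer n k).
  by rewrite addr_ge0 // divr_ge0 ?(ltW c0) // subr_ge0 ltW.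
rewrite pmulrn vol_affine ?divfK ?gt_eqF //; first by rewrite -pmulrn; lra.
apply/andP; split; first by rewrite divr_ge0 ?(ltW c0) // -pmulrn; lra.
by rewrite ler_pdivrMr // mul1r -pmulrn; move: xk; rewrite volk; lra.
Qed.

(** * Log-concave layers and concave growth of volumes *)

Lemma layer_ge0 (n : nat) (k : int) : 0 <= layer n k.
Proof. by elim: n k => [|n IHn] k /=; rewrite ?ler0n // addr_ge0. Qed.

Lemma layer_lt0 (n : nat) (k : int) : k < 0 -> layer n k = 0.
Proof.
elim: n k => [|n IHn] k k0 /=; first by rewrite lt_eqF.
by rewrite !IHn ?addr0 //; lia.
Qed.

Lemma layer0 (n : nat) : layer n 0 = 1.
Proof. by elim: n => //= n ->; rewrite layer_lt0 ?addr0. Qed.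

(** Allowing [k < l] makes the induction work: Pascal's rule produces products at unequal indices
    even from [k = l]. *)
Lemma layer_logconcave (n : nat) (k l : int) :
  k <= l -> layer n (k - 1) * layer n (l + 1) <= layer n k * layer n l.
Proof.
elim: n k l => [|n IHn] k l kl /=.
  by rewrite -!natrM ler_nat; do ![case: eqP]; lia.
rewrite addrK; have h1 := IHn _ _ kl.
have h2 : layer n (k - 1 - 1) * layer n l <= layer n (k - 1) * layer n (l - 1).
  by rewrite -{1}[l](subrK 1) IHn // lerB.
(* Two inward moves of the indices; for [k = l] the second one only swaps the factors. *)
have h3 : layer n (k - 1 - 1) * layer n (l + 1) <= layer n k * layer n (l - 1).
  apply: (@le_trans _ _ (layer n (k - 1) * layer n l)); first by apply: IHn; lia.
  have [->|k_l] := eqVneq k l; first by rewrite mulrC.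
  by rewrite -{1}[l](subrK 1) IHn //; lia.
nra.
Qed.

Lemma layer_eq0 (n : nat) (k : int) :
  0 <= k -> layer n k = 0 -> layer n (k + 1) = 0.
Proof.
move=> k0 ck; have [k00|k1] := eqVneq k 0.
  by move: ck; rewrite k00 layer0 => /eqP; rewrite oner_eq0.
have := @layer_logconcave n 1 k; rewrite subrr layer0 ck mul1r mulr0.
by move=> le0; apply/le_anti; rewrite layer_ge0 andbT le0 //; lia.
Qed.

(** A ball of parameter [t] has slices of parameters [t] and [t - 1]; a pair [s], [r] between them
    is more even, so by concavity it grows at least as much. *)
Lemma vol_concave (n : nat) (s r t : rat) :
    0 <= s -> t - 1 <= s -> s <= r -> r <= t ->
    vol n.+1 t <= vol n r + vol n s ->
  vol n.+1 (t + 1) <= vol n (r + 1) + vol n (s + 1).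
Proof.
move=> s0 ts sr rt; rewrite /= addrK.
(* k and k + 1 enclose t, so on [t - 1, t] only the slopes p and q of vol, and
   after the shift by 1 the slopes q and u, occur; concavity is p * u <= q * q. *)
have [k tk1 tk2] : exists2 k : int, k%:~R <= t & t < k%:~R + 1.
  exists (Num.floor t); first exact: floor_le.
  by rewrite -[1]/(1%:~R) -intrD floorD1_gt.
have k0 : 0 <= k by rewrite -ltzD1 -(ltr0z rat) rmorphD /=; lra.
pose a := vol n (k%:~R - 1); pose p := layer n (k - 1).
pose q := layer n k; pose u := layer n (k + 1).
have volk : vol n k%:~R = a + p.
  by have := volS n (k - 1); rewrite rmorphB /= subrK => ->.
have volk1 : vol n (k%:~R + 1) = a + p + q by rewrite volS volk.
have volE0 x : 0 <= x <= 1 -> vol n (k%:~R - 1 + x) = a + x * p.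
  by move=> x01; have := vol_affine n (k - 1) x01; rewrite rmorphB /=.
have volE1 x : 0 <= x <= 1 -> vol n (k%:~R + x) = a + p + x * q.
  by move=> x01; rewrite vol_affine // volk.
have volE2 x : 0 <= x <= 1 -> vol n (k%:~R + 1 + x) = a + p + q + x * u.
  move=> x01; have := vol_affine n (k + 1) x01.
  by rewrite rmorphD /= volk1.
have [p0 q0 u0] : [/\ 0 <= p, 0 <= q & 0 <= u] by rewrite !layer_ge0.
have pu_qq : p * u <= q * q by apply: layer_logconcave.
(* The inequalities below are proved after multiplication by [p] or [q]; these facts settle the
   cases where that factor vanishes. *)
have p_eq0 : p = 0 -> q = 0 \/ (q = 1 /\ k = 0).
  have [kE _|k_neq0 /layer_eq0] := eqVneq k 0.
    by right; rewrite /q kE layer0.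
  by rewrite subrK => qE; left; apply: qE; lia.
have q_eq0 : q = 0 -> u = 0 by apply: layer_eq0.
have [y ty] : exists y, t = k%:~R + y by exists (t - k%:~R); lra.
have -> : t - 1 = k%:~R - 1 + y by lra.
have -> : t + 1 = k%:~R + 1 + y by lra.
rewrite ty volE0 ?volE1 ?volE2; [|lra..].
(* Three cases: the breakpoint [k] lies above, between or below [s] and [r]. *)
have [sk|ks] := leP s k%:~R.
  have [x sx] : exists x, s = k%:~R - 1 + x by exists (s - k%:~R + 1); lra.
  have -> : s + 1 = k%:~R + x by lra.
  rewrite sx volE0 ?volE1; [|lra..].
  have [rk|kr] := leP r k%:~R.
    have [z rz] : exists z, r = k%:~R - 1 + z by exists (r - k%:~R + 1); lra.
    have -> : r + 1 = k%:~R + z by lra.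
    rewrite rz volE0 ?volE1; [|lra..] => h.
    have {}h : p + y * q + y * p <= z * p + x * p by lra.
    suff : q + y * u + y * q <= z * q + x * q by lra.
    have [pE|pN] := eqVneq p 0.
      have [qE|[qE kE]] := p_eq0 pE; first by rewrite (q_eq0 qE) qE; lra.
      have yE : y = 0 by move: h; rewrite pE qE; lra.
      by move: s0; rewrite sx kE mulr0z yE qE; lra.
    have p_gt0 : 0 < p by rewrite lt_def pN.
    rewrite -(ler_pM2l p_gt0).
    have yz : y * (p * u) <= y * (q * q) by rewrite ler_wpM2l //; lra.
    have := ler_wpM2l q0 h; lra.
  have [z rz] : exists z, r = k%:~R + z by exists (r - k%:~R); lra.
  have -> : r + 1 = k%:~R + 1 + z by lra.
  rewrite rz volE1 ?volE2; [|lra..] => h.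
  have {}h : (y - z) * q <= (x - y) * p by lra.
  suff : (y - z) * u <= (x - y) * q by lra.
  have [pE|pN] := eqVneq p 0.
    have [qE|[qE kE]] := p_eq0 pE; first by rewrite (q_eq0 qE) qE; lra.
    have yE : y = z by move: h; rewrite pE qE; lra.
    by rewrite yE qE; lra.
  have p_gt0 : 0 < p by rewrite lt_def pN.
  rewrite -(ler_pM2l p_gt0).
  have yz : (y - z) * (p * u) <= (y - z) * (q * q) by rewrite ler_wpM2l //; lra.
  have := ler_wpM2l q0 h; lra.
have [x sx] : exists x, s = k%:~R + x by exists (s - k%:~R); lra.
have [z rz] : exists z, r = k%:~R + z by exists (r - k%:~R); lra.
have -> : s + 1 = k%:~R + 1 + x by lra.
have -> : r + 1 = k%:~R + 1 + z by lra.
rewrite sx rz !volE1 ?volE2; [|lra..] => h.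
have {}h : (y - z) * q <= (1 - y) * p + x * q by lra.
suff : (y - z) * u <= (1 - y) * q + x * u by lra.
have [qE|qN] := eqVneq q 0; first by rewrite qE q_eq0 // !mulr0 addr0.
have q_gt0 : 0 < q by rewrite lt_def qN.
rewrite -(ler_pM2l q_gt0).
have xy : (1 - y) * (p * u) <= (1 - y) * (q * q) by rewrite ler_wpM2l //; lra.
have := ler_wpM2l u0 h; lra.
Qed.

(* [x] and [y] stand for the sizes of the two slices of the neighbourhood. *)
Lemma vol_split (n : nat) (s r t x y : rat) :
    0 <= s -> s <= r -> vol n.+1 t <= vol n r + vol n s ->
    vol n (r + 1) <= x -> vol n (s + 1) <= y -> vol n r <= y ->
  vol n.+1 (t + 1) <= x + y.
Proof.
move=> s0 sr h rx sy ry; have r0 := le_trans s0 sr.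
(* For [s + 1 <= r] the bounds in [r] alone suffice: they are the slices of the ball of parameter
   [r + 1]. *)
have [sr1|rs1] := leP (s + 1) r.
  have tr : vol n.+1 t <= vol n.+1 r.
    by apply: (le_trans h); rewrite /= lerD2l vol_homo //; lra.
  by have := vol_shift r0 tr; rewrite /= !addrK; lra.
have [ts|st] := leP (t - 1) s.
  have [rt|tr] := leP r t; first by have := vol_concave s0 ts sr rt h; lra.
  rewrite /= addrK; have : vol n (t + 1) <= vol n (r + 1) by apply: vol_homo; lra.
  have : vol n t <= vol n (s + 1) by apply: vol_homo; lra.
  lra.
(* Since [s + 1 < t], strict growth makes this possible only once [s + 1] reaches [n + 2], where all
   volumes are full. *)
have ts : vol n.+1 t <= vol n.+1 (s + 1).
  have rs : vol n r <= vol n (s + 1) by rewrite vol_homo // ltW.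
  by rewrite /= in h *; rewrite addrK; lra.
have [sn|ns] := ltP (s + 1) n.+2%:R.
  by have := @vol_strict n.+1 (s + 1) t; lra.
have full z : s <= z -> vol n z = 2 ^+ n.
  by move=> sz; apply: vol_full; move: ns; rewrite -(natr1 n.+1); lra.
move: rx sy; rewrite !full; [|lra..] => rx sy.
by apply: le_trans (vol_le_full _ _) _; rewrite exprS; lra.
Qed.

(** * Neighbourhoods, slices and the Hamming distance *)

Definition nbhd (n : nat) (A : code n) : code n :=
  [set v | [exists u in A, (hamming u v <= 1)%N]].

Definition slice (n : nat) (b : bool) (A : code n.+1) : code n :=
  [set u : n.-tuple bool | [tuple of b :: u] \in A].

Lemma hamming_sum (n : nat) (u v : n.-tuple bool) :
  hamming u v = (\sum_(i < n) (tnth u i != tnth v i))%N.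
Proof. by rewrite /hamming cardsE -sum1_card big_mkcond. Qed.

Lemma hamming_cons (n : nat) (b c : bool) (u v : n.-tuple bool) :
  hamming [tuple of b :: u] [tuple of c :: v] = ((b != c) + hamming u v)%N.
Proof.
rewrite !hamming_sum big_ord_recl; congr (_ + _)%N.
by apply: eq_bigr => i _; rewrite !tnthS.
Qed.

Lemma hammingxx (n : nat) (u : n.-tuple bool) : hamming u u = 0%N.
Proof. by rewrite hamming_sum big1 // => i _; rewrite eqxx. Qed.

Lemma hammingC (n : nat) (u v : n.-tuple bool) : hamming u v = hamming v u.
Proof. by rewrite !hamming_sum; apply: eq_bigr => i _; rewrite eq_sym. Qed.

Lemma hamming_triangle (n : nat) (v u w : n.-tuple bool) :
  (hamming u w <= hamming u v + hamming v w)%N.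
Proof.
rewrite !hamming_sum -big_split leq_sum // => i _.
by case: (tnth u i) (tnth v i) (tnth w i) => [] [] [].
Qed.

Lemma hamming_le (n : nat) (u v : n.-tuple bool) : (hamming u v <= n)%N.
Proof. by rewrite /hamming (leq_trans (max_card _)) // card_ord. Qed.

Lemma card_slice (n : nat) (b : bool) (A : code n.+1) :
  #|A| = (#|slice b A| + #|slice (~~ b) A|)%N.
Proof.
pose cons_b (c : bool) (u : n.-tuple bool) := [tuple of c :: u].
have cons_inj c : injective (cons_b c).
  by move=> u v /(congr1 (@tval _ _)) [] /val_inj.
have cardE c : #|slice c A| = #|[set u in A | thead u == c]|.
  rewrite -(card_imset _ (cons_inj c)); apply: eq_card => u.
  rewrite !inE; apply/imsetP/andP => [[v + ->]|[uA /eqP <-]].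
    by rewrite inE theadE.
  by exists [tuple of behead u]; rewrite ?inE /cons_b -tuple_eta.
rewrite !cardE -(cardsID [set u | thead u == b] A).
congr (_ + _)%N; apply: eq_card => u; rewrite !inE andbC //.
by case: (thead u) b (u \in A) => [] [] [].
Qed.

Lemma nbhd_slice (n : nat) (b : bool) (A : code n.+1) :
  nbhd (slice b A) \subset slice b (nbhd A).
Proof.
apply/subsetP => v; rewrite !inE => /exists_inP [u]; rewrite inE => uA uv.
by apply/exists_inP; exists [tuple of b :: u]; rewrite // hamming_cons eqxx.
Qed.

Lemma slice_nbhd (n : nat) (b : bool) (A : code n.+1) :
  slice b A \subset slice (~~ b) (nbhd A).
Proof.
apply/subsetP => v; rewrite !inE => vA.
apply/exists_inP; exists [tuple of b :: v]; rewrite // hamming_cons hammingxx.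
by case: b {vA}.
Qed.

(** * Vertex-isoperimetric inequality *)

(* The factor 2 (slicing stops at dimension 1, not 0) is what makes the bound
   sharp for odd diameters as well as for even ones. *)
Lemma nbhd_card (n : nat) (A : code n.+1) (t : rat) :
    A != set0 -> 2 * vol n t <= #|A|%:R ->
  2 * vol n (t + 1) <= #|nbhd A|%:R.
Proof.
elim: n A t => [|n IHn] A t A0 At.
  suff -> : nbhd A = setT.
    by rewrite cardsT card_tuple card_bool ler_piMr // (vol_le_full 0).
  apply/setP => v; rewrite !inE; have /set0Pn [u uA] := A0.
  by apply/exists_inP; exists u; rewrite ?hamming_le.
have [b Ab] : exists b, (#|slice (~~ b) A| <= #|slice b A|)%N.
  by case/orP: (leq_total #|slice true A| #|slice false A|);
    [exists false | exists true].
(* Slices have up to [2 ^ n.+1] points while [vol n] stops at [2 ^+ n], hence the halving. *)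
have vol_of c : exists2 s, 0 <= s & vol n s = #|slice c A|%:R / 2.
  apply: vol_inv; rewrite divr_ge0 // ler_pdivrMr // -exprSr -natrX ler_nat.
  by rewrite (leq_trans (max_card _)) // card_tuple card_bool.
have [r r0 rE] := vol_of b; have [s s0 sE] := vol_of (~~ b).
move: At; rewrite (card_slice b) (card_slice b (nbhd A)) !natrD => At.
have h1 : #|nbhd (slice b A)|%:R <= #|slice b (nbhd A)|%:R :> rat.
  by rewrite ler_nat subset_leq_card ?nbhd_slice.
have h2 : #|nbhd (slice (~~ b) A)|%:R <= #|slice (~~ b) (nbhd A)|%:R :> rat.
  by rewrite ler_nat subset_leq_card ?nbhd_slice.
have h3 : #|slice b A|%:R <= #|slice (~~ b) (nbhd A)|%:R :> rat.
  by rewrite ler_nat subset_leq_card ?slice_nbhd.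
have Ab0 : slice b A != set0.
  apply: contraNneq A0 => Ab0; rewrite -cards_eq0 (card_slice b).
  by move: Ab; rewrite Ab0 cards0 leqn0 => ->.
have IHb : 2 * vol n (r + 1) <= #|nbhd (slice b A)|%:R by apply: IHn => //; lra.
(* The induction hypothesis needs a nonempty slice; if this one is empty, the copy given by [h3] is
   enough. *)
have [sA0|sA0] := eqVneq (slice (~~ b) A) set0.
  have tr : vol n.+1 t <= vol n.+1 r.
    have := vol_ge0 n (r - 1); rewrite sA0 cards0 in At; rewrite /= in At *; lra.
  by have := vol_shift r0 tr; rewrite /= !addrK; lra.
have IHs : 2 * vol n (s + 1) <= #|nbhd (slice (~~ b) A)|%:R.
  by apply: IHn => //; lra.
rewrite -(ler_nat rat) in Ab.
have h4 : vol n.+1 t <= vol n r + vol n s by lra.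
have [sr|/ltW rs] := leP s r.
  have := @vol_split n s r t (#|slice b (nbhd A)|%:R / 2) 
     (#|slice (~~ b) (nbhd A)|%:R / 2) s0 sr h4; lra.
(* Parameters are not unique where [vol n] is full, so the larger slice may get the smaller one; the
   volumes then agree and [r] serves for both. *)
have rsE : vol n s = vol n r by have := vol_homo n rs; lra.
have := @vol_split n r r t (#|slice b (nbhd A)|%:R / 2) 
     (#|slice (~~ b) (nbhd A)|%:R / 2) r0 (lexx r).
have : vol n (r + 1) <= vol n (s + 1) by apply: vol_homo; lra.
lra.
Qed.

Lemma iter_nbhd_card (n k : nat) (A : code n.+1) (t : rat) :
    A != set0 -> 2 * vol n t <= #|A|%:R ->
  2 * vol n (t + k%:R) <= #|iter k (@nbhd n.+1) A|%:R.
Proof.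
move=> A0 At; elim: k => [|k IHk]; first by rewrite addr0.
rewrite -(natr1 k) addrA /=; apply: nbhd_card => //.
elim: k {IHk} => //= k /set0Pn [u uA]; apply/set0Pn; exists u.
by rewrite inE; apply/exists_inP; exists u; rewrite ?hammingxx.
Qed.

Lemma iter_nbhd_hamming (n k : nat) (A : code n) (v : n.-tuple bool) :
  v \in iter k (@nbhd n) A -> exists2 u, u \in A & (hamming u v <= k)%N.
Proof.
elim: k v => [|k IHk] v /=; first by exists v; rewrite ?hammingxx.
rewrite inE => /exists_inP [w /IHk [u uA uw] wv]; exists u => //.
by rewrite (leq_trans (hamming_triangle w _ _)) // -addn1 leq_add.
Qed.

(** * Antipodes and the bound for two codes *)

Definition antipode (n : nat) (v : n.-tuple bool) : n.-tuple bool :=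
  [tuple of map negb v].

Lemma antipode_inj (n : nat) : injective (@antipode n).
Proof.
by move=> u v /(congr1 val) /= /(inj_map negb_inj) /val_inj.
Qed.

Lemma hamming_antipode (n : nat) (u v : n.-tuple bool) :
  (hamming u (antipode v) + hamming u v)%N = n.
Proof.
rewrite !hamming_sum -big_split /= -[RHS]card_ord -sum1_card.
apply: eq_bigr => i _; rewrite tnth_map.
by case: (tnth u i) (tnth v i) => [] [].
Qed.

Lemma cross_diameter_card (n d : nat) (A B : code n.+1) :
    (d <= n)%N ->
    (forall u v, u \in A -> v \in B -> (hamming u v <= d)%N) ->
    2 * vol n (d.+1%:R / 2) <= #|A|%:R ->
  #|B|%:R <= 2 * vol n (d.+1%:R / 2).
Proof.
move=> dn AB At; set t := d.+1%:R / 2 in At *.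
have t0 : 0 < t by rewrite divr_gt0 ?ltr0n.
have A0 : A != set0.
  apply: contraTneq At => ->; rewrite cards0 -ltNge mulr_gt0 //.
  by rewrite -(@vol_le0 n 0) // vol_strict ?ltr0n.
have := iter_nbhd_card (n - d) A0 At.
(* [2 * t = d + 1], so [n - d] steps lead exactly to the parameter of the complementary ball. *)
have -> : t + (n - d)%:R = n.+1%:R - t.
  by rewrite natrB // /t -(natr1 d) -(natr1 n); lra.
have := vol_sym n t; set N := iter _ _ _ => volE NE.
(* Points of [N] are within [n - d] of some point of [A], antipodes of [B] at least [n + 1 - d] from
   all of [A]. *)
have : [disjoint N & @antipode _ @: B].
  rewrite -setI_eq0; apply/set0Pn => -[w /setIP [wN /imsetP [v vB wE]]].
  have [u uA] := iter_nbhd_hamming wN; rewrite wE.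
  have := hamming_antipode u v; have := AB u v uA vB; lia.
have /leqifP := leq_card_setU N (@antipode _ @: B).
case: ifP => // _ /eqP cardE _.
have : (#|N| + #|B| <= 2 ^ n.+1)%N.
  rewrite -(card_imset B (@antipode_inj _)) -cardE (leq_trans (max_card _)) //.
  by rewrite card_tuple card_bool.
rewrite -(ler_nat rat) natrD natrX exprS => NB; lra.
Qed.

(** * Extremal codes of given diameter *)

Definition zeros (n : nat) : n.-tuple bool := [tuple of nseq n false].

Lemma card_ball (n k : nat) :
  #|[set u : n.-tuple bool | (hamming (zeros n) u < k)%N]|%:R = vol n k%:R.
Proof.
elim: n k => [|n IHn] k.
  case: k => [|k].
    by rewrite vol_le0 // (eq_card (B := set0)) ?cards0 // => u; rewrite !inE.
  rewrite (@vol_full 0) ?ler_nat // (eq_card (B := setT)) ?cardsT ?card_tuple //.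
  by move=> u; rewrite !inE (leq_ltn_trans (hamming_le _ _)).
have zerosE : zeros n.+1 = [tuple of false :: zeros n] by apply: val_inj.
rewrite (card_slice false) natrD /= -IHn; congr (_ + _).
  by congr (_%:R); apply: eq_card => u; rewrite !inE zerosE hamming_cons.
case: k => [|k].
  rewrite vol_le0 ?subr_le0 // (eq_card (B := set0)) ?cards0 // => u.
  by rewrite !inE.
rewrite -natr1 addrK -IHn; congr (_%:R); apply: eq_card => u.
by rewrite !inE zerosE hamming_cons add1n ltnS.
Qed.

(** For even [d] the code is a ball of radius [d / 2]; for odd [d] it is a ball of radius
    [(d - 1) / 2] in the [n]-cube times a free bit. *)
Lemma diameter_code (n d : nat) : exists2 C : code n.+1,
  (forall u v, u \in C -> v \in C -> (hamming u v <= d)%N) &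
  #|C|%:R = 2 * vol n (d.+1%:R / 2).
Proof.
pose C : code n.+1 := [set u : n.+1.-tuple bool |
  (2 * hamming (zeros n) [tuple of behead u] + thead u <= d)%N].
have CE (b : bool) (u : n.-tuple bool) :
  ([tuple of b :: u] \in C) = (2 * hamming (zeros n) u + b <= d)%N.
  rewrite inE theadE; congr (_ * hamming _ _ + _ <= _)%N; exact: val_inj.
exists C => [u v|].
  (* If [b != c], then [x + y <= d - 1 / 2], hence at most [d - 1], which leaves room for the
     differing bit. *)
  have arith (b c : bool) (x y z : nat) : (z <= x + y)%N ->
      (2 * x + b <= d)%N -> (2 * y + c <= d)%N -> ((b != c) + z <= d)%N.
    by case: b c => [] []; lia.
  rewrite (tuple_eta u) (tuple_eta v) !CE hamming_cons; apply: arith.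
  by rewrite [X in (_ <= X + _)%N]hammingC hamming_triangle.
have ballE (b : bool) k : (forall m, (2 * m + b <= d) = (m < k))%N ->
    #|slice b C|%:R = vol n k%:R.
  move=> dk; rewrite -card_ball; congr (_%:R); apply: eq_card => u.
  by rewrite [LHS]inE CE inE dk.
rewrite (card_slice false) natrD (ballE _ d./2.+1) ?(ballE _ (uphalf d)) /=;
  last 2 first.
- by move=> m; lia.
- by move=> m; lia.
have dE : d.+1%:R = (odd d)%:R + 2 * d./2%:R + 1 :> rat.
  by rewrite -{1}[d]odd_double_half -natr1 natrD -mul2n natrM.
(* For odd [d] the slices have equal size; for even [d] their mean is the interpolated volume at the
   midpoint. *)
rewrite uphalf_half dE; case: (odd d) => /=; rewrite ?add1n ?add0n -(natr1 d./2).
  have -> : (1%:R + 2 * d./2%:R + 1) / 2 = d./2%:R + 1 :> rat by lra.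
  lra.
have -> : (0%:R + 2 * d./2%:R + 1) / 2 = d./2%:R + 1 / 2 :> rat by lra.
by rewrite pmulrn volS vol_affine; lra.
Qed.

(* Comparison of the two maxima *)
Local Close Scope ring_scope.

Theorem corollary1 (n delta : nat) (hn : 1 <= n) :
  F 1 n delta = F 2 n delta /\
  (forall (C1 : {ffun 'I_1 -> code n}) (C2 : {ffun 'I_2 -> code n}),
     optimal_LP delta C1 -> optimal_LP delta C2 -> LP_size C2 = LP_size C1).
Proof.
suff FE : F 1 n delta = F 2 n delta.
  by split=> // C1 C2 [_ ->] [_ ->].
have LP1 (C : code n) :
    (forall u v, u \in C -> v \in C -> hamming u v <= delta) ->
  #|C| <= F 1 n delta.
  move=> dC; pose C' := [ffun _ : 'I_1 => C].
  have LPC : is_LP delta C'.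
    apply/forallP => i; rewrite !ffunE; apply/forall_inP => u uC.
    by apply/forall_inP => v; apply: dC.
  have [i] := LP_size_attained C' isT; rewrite ffunE => <-.
  exact: leq_bigmax_cond.
apply/eqP; rewrite eqn_leq; apply/andP; split.
  have [C [LPC <-]] := F_attained 1 n delta.
  pose C' := [ffun _ : 'I_2 => C ord0].
  have LPC' : is_LP delta C'.
    apply/forallP => i; rewrite !ffunE.
    by have /forallP /(_ ord0) := LPC; rewrite [ordS _]ord1.
  apply: leq_trans (LP_size_le C ord0) _.
  have [i] := LP_size_attained C' isT; rewrite ffunE => <-.
  exact: leq_bigmax_cond.
have [C [LPC <-]] := F_attained 2 n delta.
(* For [n <= delta] distances impose nothing; otherwise, in dimension [n.+1], [dn] is the bound
   [delta <= n] required by [cross_diameter_card]. *)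
have [nd|dn] := leqP n delta.
  apply: leq_trans (LP_size_le C ord0) (leq_trans (subset_leq_card (subsetT _)) _).
  by apply: LP1 => u v _ _; rewrite (leq_trans (hamming_le _ _)).
case: n hn C LPC LP1 dn => // n _ C LPC LP1 dn.
have [K dK KE] := diameter_code n delta.
apply: leq_trans (LP1 K dK); rewrite leqNgt; apply/negP => KC.
have C0 := leq_trans KC (LP_size_le C ord0).
have C1 := leq_trans KC (LP_size_le C (ordS ord0)).
have := @cross_diameter_card n delta (C ord0) (C (ordS ord0)) dn.
rewrite -KE !ler_nat => /(_ _ (ltnW C0)) H.
suff /H : forall u v, u \in C ord0 -> v \in C (ordS ord0) -> (hamming u v <= delta).
  by rewrite leqNgt C1.
move=> u v uC vC; have /forallP /(_ ord0) /forall_inP /(_ u uC) := LPC.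
by move/forall_inP; apply.
Qed.
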